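(* Let $(X,K,\|\cdot\|)$ be a real ordered Banach space whose closed cone $K$ is normal and satisfies $\mathrm{int}(K)\neq\varnothing$. Let $A\in L(X)$ be a positive operator such that 1) for each vector $x\in K$, $x\ne 0$, there exists a natural number $n_x$ such that $A^{n_x}(x)\in \mathrm{int}(K)$; 2) some power of $A$ is a compact operator; 3) $\sup_{n\in\mathbb{N}}\|A^n\|<+\infty$. Then the sequence $\{A^n\}_{n\ge 0}$ converges pointwise (i.e. in norm at each $x\in X$) to some operator $A_0\in L(X)$. If $A_0$ is not zero, then there exist a vector $u\in\mathrm{int}(K)$ and a functional $f_0\in K'$ such that (i) $A(u)=u$, $A^*(f_0)=f_0$, $f_0(u)=1$, and moreover $f_0(x)>0$ if $x\in K$, $x\ne 0$; (ii) $A_0=f_0\otimes u$; (iii) for each $f\in X'$ one has $(A^* )^n(f)\to A_0^*(f)$ as $n\to+\infty$ with respect to the weak*-topology $\sigma(X',X)$; (iv) $\lambda=1$ is a simple eigenvalue of the operators $A$ and $A^*$. Moreover (whether or not $A_0$ is zero), (v) $\|A^n-A_0\|\to 0$ as $n\to\infty$, i.e. the operators $A^n$ (and also the adjoint operators $(A^n)^*$) converge to $A_0$ (respectively to $A_0^*$) with respect to the operator norm.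
   Context: A cone $K$ in a real vector space is a nonempty subset with $\lambda x+\mu y\in K$ for $x,y\in K$, $\lambda,\mu\ge 0$, and such that $x,-x\in K$ implies $x=0$. An ordered Banach space $(X,K,\|\cdot\|)$ is a real Banach space $X$ ordered by a closed cone $K$ ($x\le y$ iff $y-x\in K$). $K$ is normal if there is $\delta>0$ with $\|x+y\|\ge\delta\max\{\|x\|,\|y\|\}$ for all $x,y\in K$. $\mathrm{int}(K)$ is the norm interior of $K$. $X'$ is the dual of $X$ and $K'=\{f\in X': f(x)\ge 0 \text{ for all } x\in K\}$. $L(X)$ is the space of continuous linear operators on $X$; $A\in L(X)$ is positive if $A(K)\subset K$; $A^*$ is its adjoint on $X'$. ''Some power'' means $A^k$ for some $k\in\mathbb{N}=\{1,2,\dots\}$. For $f\in X'$, $u\in X$, $f\otimes u$ is the operator $x\mapsto f(x)u$. An eigenvalue is called simple if its eigenspace is one-dimensional. *)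

(* Defs.v *)
From HB Require Import structures.
From mathcomp Require Import all_boot all_order all_algebra.
From mathcomp Require Import all_classical all_reals all_analysis.

Set Implicit Arguments.
Unset Strict Implicit.
Unset Printing Implicit Defensive.

Import Order.TTheory GRing.Theory Num.Theory.
Import numFieldNormedType.Exports.

Local Open Scope classical_set_scope.
Local Open Scope ring_scope.

Section BoundedOperators.
Context {R : realType} {X Y : normedModType R}.

Definition contlin : {pred X -> Y} :=
  [pred f | `[< linear f /\ continuous f >]].

Record bounded_op : Type := BoundedOp {
  bounded_op_fun :> X -> Y;
  bounded_opP : bounded_op_fun \in contlin }.

HB.instance Definition _ := [isSub for bounded_op_fun].
HB.instance Definition _ := gen_eqMixin bounded_op.
HB.instance Definition _ := gen_choiceMixin bounded_op.

Lemma bounded_op_linear (f : bounded_op) : linear f.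
Proof. by case: f => f /= /asboolP[]. Qed.

Lemma bounded_op_continuous (f : bounded_op) : continuous f.
Proof. by case: f => f /= /asboolP[]. Qed.

HB.instance Definition _ (f : bounded_op) :=
  GRing.isLinear.Build R X Y *:%R (f : X -> Y) (bounded_op_linear f).

Lemma contlin_submod_closed : submod_closed contlin.
Proof.
split.
  apply/asboolP; split; last exact: cst_continuous.
  by move=> a x y /=; rewrite scaler0 addr0.
move=> a f g /asboolP[lf cf] /asboolP[lg cg]; apply/asboolP; split.
  move=> b x y; rewrite /= !fctE lf lg !scalerDr !scalerA [b * a]mulrC.
  by rewrite addrACA.
move=> x; apply: cvgD; last exact: cg.
by apply: cvgZl_tmp; exact: cf.
Qed.

HB.instance Definition _ :=
  GRing.isSubmodClosed.Build R (X -> Y) contlin contlin_submod_closed.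

HB.instance Definition _ := [SubChoice_isSubLmodule of bounded_op by <:].

Lemma bounded_op_eqP (f g : bounded_op) : f =1 g -> f = g.
Proof. by move=> fg; apply/val_inj/funext. Qed.

Definition opnorm (f : bounded_op) : R :=
  sup [set `|f x| | x in [set x : X | `|x| <= 1]].

Lemma bounded_op_bounded (f : bounded_op) :
  exists2 M, 0 <= M & forall x, `|f x| <= M * `|x|.
Proof.
have /linear_bounded_continuous/linear_boundedP := @bounded_op_continuous f.
by move=> /pinfty_ex_gt0[M /ltW M0 fM]; exists M.
Qed.

Lemma opnorm_has_sup (f : bounded_op) :
  has_sup [set `|f x| | x in [set x : X | `|x| <= 1]].
Proof.
split; first by exists `|f 0|, 0 => //=; rewrite normr0.
have [M M0 fM] := bounded_op_bounded f; exists M => _ [x /= x1 <-].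
by rewrite (le_trans (fM x))// ler_piMr.
Qed.

Lemma le_opnorm_unit (f : bounded_op) x : `|x| <= 1 -> `|f x| <= opnorm f.
Proof.
by move=> x1; apply: ub_le_sup; [case: (opnorm_has_sup f)|exists x].
Qed.

Lemma opnorm_ge0 f : 0 <= opnorm f.
Proof.
by rewrite (le_trans (normr_ge0 (f 0)))// le_opnorm_unit// normr0.
Qed.

Lemma le_opnorm (f : bounded_op) x : `|f x| <= opnorm f * `|x|.
Proof.
have [->|x0] := eqVneq x 0; first by rewrite linear0 !normr0 mulr0.
have nx0 : 0 < `|x| by rewrite normr_gt0.
rewrite -ler_pdivrMr// mulrC -{1}[`|x|]gtr0_norm// -normfV -normrZ -linearZ.
by apply: le_opnorm_unit; rewrite normrZ normfV normr_id mulVf ?gt_eqF.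
Qed.

Lemma opnorm_le (f : bounded_op) M :
  0 <= M -> (forall x, `|f x| <= M * `|x|) -> opnorm f <= M.
Proof.
move=> M0 fM; apply: ge_sup; first by case: (opnorm_has_sup f).
by move=> _ [x /= x1 <-]; rewrite (le_trans (fM x))// ler_piMr.
Qed.

Lemma opnormD f g : opnorm (f + g) <= opnorm f + opnorm g.
Proof.
apply: opnorm_le => [|x]; first by rewrite addr_ge0 ?opnorm_ge0.
by rewrite mulrDl (le_trans (ler_normD _ _))// lerD ?le_opnorm.
Qed.

Let opnormZ_le a f : opnorm (a *: f) <= `|a| * opnorm f.
Proof.
apply: opnorm_le => [|x]; first by rewrite mulr_ge0 ?opnorm_ge0.
by rewrite normrZ -mulrA ler_wpM2l ?le_opnorm.
Qed.

Lemma opnormZ a f : opnorm (a *: f) = `|a| * opnorm f.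
Proof.
apply/le_anti; rewrite opnormZ_le/=.
have [->|a0] := eqVneq a 0; first by rewrite normr0 mul0r opnorm_ge0.
rewrite -ler_pdivlMl ?normr_gt0// -normfV.
by rewrite -{1}[f]scale1r -(mulVf a0) -scalerA opnormZ_le.
Qed.

Lemma opnorm_eq0 f : opnorm f = 0 -> f = 0.
Proof.
move=> f0; apply: bounded_op_eqP => x; apply/normr0_eq0/le_anti.
by rewrite normr_ge0 (le_trans (le_opnorm f x))// f0 mul0r.
Qed.

HB.instance Definition _ := Lmodule_isNormed.Build R bounded_op
  opnormD opnormZ opnorm_eq0.

Lemma contlinP (f : X -> Y) M : linear f ->
  (forall x, `|f x| <= M * `|x|) -> f \in contlin.
Proof.
move=> lf fM; apply/asboolP; split => //.
pose g : {linear X -> Y} := HB.pack f (GRing.isLinear.Build R X Y *:%R f lf).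
apply: (@bounded_linear_continuous _ _ _ g); apply/linear_boundedP.
exists M; split=> [|r /ltW Mr x]; first exact: num_real.
by rewrite (le_trans (fM x))// ler_wpM2r.
Qed.

End BoundedOperators.
Arguments bounded_op {R} X Y.

Section Operators.
Context {R : realType}.
Implicit Types X Y Z : normedModType R.

Lemma op_id_subproof X : (id : X -> X) \in contlin.
Proof. by apply/asboolP; split=> // x; exact: cvg_id. Qed.

Definition op_id X : bounded_op X X := BoundedOp (op_id_subproof X).

Lemma op_comp_subproof X Y Z (g : bounded_op Y Z) (f : bounded_op X Y) :
  (g : Y -> Z) \o f \in contlin.
Proof.
apply/asboolP; split=> [a x y|x]; first by rewrite /= !linearP.
by apply: continuous_comp; exact: bounded_op_continuous.
Qed.

Definition op_comp X Y Z (g : bounded_op Y Z) (f : bounded_op X Y) :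
  bounded_op X Z := BoundedOp (op_comp_subproof g f).

Definition op_pow X (A : bounded_op X X) (n : nat) : bounded_op X X :=
  iter n (op_comp A) (op_id X).

Definition topdual X : normedModType R := bounded_op X R^o.

Lemma adjoint_subproof X Y (A : bounded_op X Y) :
  (fun g : topdual Y => op_comp g A : topdual X) \in contlin.
Proof.
apply: (@contlinP _ _ _ _ (opnorm A)) => [a g h|g].
  exact: bounded_op_eqP.
apply: opnorm_le => [|x]; first by rewrite mulr_ge0 ?opnorm_ge0.
rewrite (le_trans (le_opnorm g _))// [X in _ <= X * _]mulrC -mulrA.
by apply: ler_wpM2l; [exact: opnorm_ge0|exact: le_opnorm].
Qed.

Definition adjoint X Y (A : bounded_op X Y) :
  bounded_op (topdual Y) (topdual X) := BoundedOp (adjoint_subproof A).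

Lemma rank_one_subproof X Y (f : topdual X) (u : Y) :
  (fun x : X => (f x : R) *: u) \in contlin.
Proof.
apply: (@contlinP _ _ _ _ (opnorm f * `|u|)) => [a x y|x].
  by rewrite linearP scalerDl scalerA.
by rewrite normrZ mulrAC ler_wpM2r// le_opnorm.
Qed.

Definition rank_one X Y (f : topdual X) (u : Y) : bounded_op X Y :=
  BoundedOp (rank_one_subproof f u).

Definition compact_op X Y (A : bounded_op X Y) :=
  forall B : set X, bounded_set B -> precompact (A @` B).

Definition eigenspace_op X (A : bounded_op X X) (a : R) : set X :=
  [set x | A x = a *: x].

Definition simple_eigenvalue X (A : bounded_op X X) (a : R) :=
  exists2 v : X, v != 0 & eigenspace_op A a = [set c *: v | c in [set: R]].

(* sigma(X', X): the coarsest topology on X' for which every evaluation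
   f |-> f x is continuous. *)
Definition weak_star X : Type := topdual X.

HB.instance Definition _ X := Topological.copy (weak_star X)
  (sup_topology (fun x : X =>
    Topological.class (initial_topology (fun f : topdual X => f x)))).

Definition cone X (K : set X) :=
  [/\ K !=set0,
      forall x y (a b : R), K x -> K y -> 0 <= a -> 0 <= b ->
        K (a *: x + b *: y) &
      forall x, K x -> K (- x) -> x = 0].

Definition normal_cone X (K : set X) :=
  exists2 delta : R, 0 < delta &
    forall x y, K x -> K y -> delta * Num.max `|x| `|y| <= `|x + y|.

Definition positive_op X (K : set X) (A : bounded_op X X) := A @` K `<=` K.

Definition dual_cone X (K : set X) : set (topdual X) :=
  [set f | forall x, K x -> 0 <= f x].

End Operators.

(* Main.v *)
Require Import Defs.
From HB Require Import structures.
From mathcomp Require Import all_boot all_order all_algebra.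
From mathcomp Require Import all_classical all_reals all_analysis.

Set Implicit Arguments.
Unset Strict Implicit.
Unset Printing Implicit Defensive.

Import Order.TTheory GRing.Theory Num.Theory.
Import numFieldNormedType.Exports.

Local Open Scope classical_set_scope.
Local Open Scope ring_scope.

(** Fix [e] in the interior of the cone.  Every vector is squeezed between
    multiples of [e] ([interior_order_unit]) and, the cone being normal, order
    bounds control norms ([normal_le_norm]).  Since the powers of [A] are
    uniformly bounded, an orbit that comes arbitrarily close to a fixed point
    converges to it ([cvg_of_near_fixpoint]).

    If the orbit of [e] comes arbitrarily close to [0], it tends to [0]; by the
    order bounds so does every orbit, and the limit operator is [0].

    Otherwise the orbit of [e] stays away from [0], and one minimisation
    principle, [compact_ratio_attained], does the work.  On a nonempty compact
    [A]-invariant set [Om], consider the least [c] such that [h z <= c *: g z]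
    for some [z] in [Om].  If the inequality is not an equality at a minimiser
    [z], some power of [A] sends the difference into the interior of the cone,
    so the image of [z] under that power satisfies it with a smaller [c],
    which is absurd.  Hence [h z = c *: g z].  It is applied to closures of
    orbit tails ([tail_closure]), which are compact because a power of [A] is:

    - with [g = id] and [h = A] on the orbit of [e], it gives an eigenvector of
      [A] in the cone; its eigenvalue is [1], since the powers are bounded and
      the orbit of [e] does not tend to [0], and it lies in the interior of the
      cone ([interior_fixpoint]);
    - with [g] constantly this fixed vector [u] and [h = id] on the orbit of an
      arbitrary [x], it shows that a multiple of [u] is a cluster point of the
      orbit, hence its limit ([cvg_to_fixed_line]).

    The coefficient of [u] in the limit is the functional [f0]
    ([limit_functional]), and the properties of [u] and [f0] are read off from
    [A^n x --> f0(x) u].  Finally, pointwise convergence of the uniformly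
    bounded powers is uniform on the compact closure of the image of the unit
    ball under a power of [A], and this is convergence in operator norm
    ([opnorm_cvg]). *)

(** * The order defined by a cone *)

Section ConeOrder.
Context {R : realType} {X : normedModType R} {K : set X}.
Context (K_cone : cone K).
Implicit Types (a : R) (x y z e v w : X).

Lemma coneZ a x : 0 <= a -> K x -> K (a *: x).
Proof.
case: K_cone => _ KD _ a0 Kx.
by rewrite -[_ *: x]addr0 -(scale0r x); apply: KD.
Qed.

Lemma cone0 : K 0.
Proof. by case: K_cone => -[x Kx] _ _; rewrite -(scale0r x); apply: coneZ. Qed.

Lemma coneD x y : K x -> K y -> K (x + y).
Proof.
case: K_cone => _ KD _ Kx Ky.
by rewrite -[x]scale1r -[y]scale1r; apply: KD.
Qed.

Lemma cone_anti x : K x -> K (- x) -> x = 0.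
Proof. by case: K_cone => _ _; apply. Qed.

Lemma cone_scale_ge0 a x : K x -> x != 0 -> K (a *: x) -> 0 <= a.
Proof.
move=> Kx x0 Kax; rewrite leNgt; apply/negP => a0.
have Knax : K (- (a *: x)).
  by rewrite -scaleNr; apply: coneZ; rewrite // oppr_ge0 ltW.
have /eqP := cone_anti Kax Knax.
by rewrite scaler_eq0 (negbTE x0) orbF lt_eqF.
Qed.

(** [e - x / (C |x|)] stays in a ball around [e] contained in the cone. *)
Lemma interior_order_unit e : K° e ->
  exists2 C : R, 0 < C & forall x, K ((C * `|x|) *: e - x).
Proof.
move=> /nbhs_ballP[r /= r0 rK]; exists (2 / r); first by rewrite divr_gt0.
move=> x; have [->|x0] := eqVneq x 0.
  by rewrite normr0 mulr0 scale0r subr0; exact: cone0.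
have nx : 0 < `|x| by rewrite normr_gt0.
set a := 2 / r * `|x|; have a0 : 0 < a by rewrite mulr_gt0 // divr_gt0.
have -> : a *: e - x = a *: (e - a^-1 *: x).
  by rewrite scalerBr scalerA divff ?lt0r_neq0// scale1r.
apply: coneZ; first exact: ltW.
apply: rK; rewrite -ball_normE /= opprB addrC subrK normrZ.
rewrite gtr0_norm ?invr_gt0//.
rewrite /a invfM mulfVK ?gt_eqF// invf_div.
by rewrite ltr_pdivrMr// ltr_pMr// ltr1n.
Qed.

(** Strict gain: a small multiple of any vector can be taken away from an
    interior one.  This is what contradicts minimality in
    [compact_ratio_attained]. *)
Lemma interior_absorb v x : K° v -> exists2 a : R, 0 < a & K (v - a *: x).
Proof.
move=> Kv; have [C C0 CK] := interior_order_unit Kv.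
have d0 : 0 < C * `|x| + 1 by rewrite ltr_wpDl// mulr_ge0// ltW.
exists (C * `|x| + 1)^-1; first by rewrite invr_gt0.
set d := (X in X^-1) in d0 *.
have -> : v - d^-1 *: x = d^-1 *: (d *: v - x).
  by rewrite scalerBr scalerA mulVf ?lt0r_neq0// scale1r.
apply: coneZ; first by rewrite invr_ge0 ltW.
rewrite /d scalerDl scale1r addrAC; apply: coneD => //.
exact: interior_subset.
Qed.

Lemma interior_ge v w a : 0 < a -> K° v -> K (w - a *: v) -> K° w.
Proof.
move=> a0 /nbhs_ballP[r /= r0 rK] Kwv.
apply/nbhs_ballP; exists (a * r); first by rewrite /= mulr_gt0.
move=> y; rewrite -ball_normE /= => wy.
have -> : y = a *: (v - a^-1 *: (w - y)) + (w - a *: v).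
  rewrite scalerBr scalerA divff ?gt_eqF// scale1r opprB addrC.
  by rewrite addrA subrK addrC subrK.
apply: coneD => //; apply: coneZ; first exact: ltW.
apply: rK; rewrite -ball_normE /= opprB addrC subrK normrZ.
rewrite gtr0_norm ?invr_gt0//.
by rewrite mulrC ltr_pdivrMr// mulrC.
Qed.

(** [0] is interior only if the cone is the whole space, and a pointed cone is
    the whole space only if the space is zero. *)
Lemma interior_neq0 e x : K° e -> K x -> x != 0 -> e != 0.
Proof.
move=> + Kx x0; apply: contraPneq => -> /interior_order_unit[C _ CK].
move/eqP: x0; apply; apply: cone_anti => //.
by have := CK x; rewrite scaler0 sub0r.
Qed.

(** The hypotheses say that [- z <= y <= z]; normality is applied to [z - y] and
    [z + y], whose sum is [2 z]. *)
Lemma normal_le_norm : normal_cone K ->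
  exists2 N : R, 0 < N & forall y z, K (z - y) -> K (z + y) -> `|y| <= N * `|z|.
Proof.
move=> [d d0 dK]; exists (2 / d + 1); first by rewrite addr_gt0 ?divr_gt0.
move=> y z Kzy Kzy'; have := dK _ _ Kzy Kzy'.
rewrite addrACA addNr addr0 -mulr2n -scaler_nat normrZ normr_nat => dyz.
have zy : `|z + y| <= 2 / d * `|z|.
  rewrite mulrAC ler_pdivlMr// mulrC (le_trans _ dyz)// ler_pM2l//.
  by rewrite le_max lexx orbT.
rewrite -[y](addKr z) (le_trans (ler_normD _ _))// normrN.
by rewrite mulrDl mul1r addrC lerD2r.
Qed.

End ConeOrder.

(** * Powers of an operator *)

Lemma scaler_injl (F : fieldType) (V : lmodType F) (u : V) (a b : F) :
  u != 0 -> a *: u = b *: u -> a = b.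
Proof.
move=> u0 /eqP.
rewrite -subr_eq0 -scalerBl scaler_eq0 (negbTE u0) orbF subr_eq0.
by move/eqP.
Qed.

Lemma geometric_small (R : realType) (M q b : R) :
  0 <= q < 1 -> 0 < b -> exists n, M * q ^+ n < b.
Proof.
move=> /andP[q0 q1] b0.
have : M * q ^+ n @[n --> \oo] --> M * 0.
  by apply: cvgMr; apply: cvg_expr; rewrite ger0_norm.
rewrite mulr0 => /cvgr_lt/(_ _ b0)[n _ nb].
by exists n; apply: nb => /=.
Qed.

Section Powers.
Context {R : realType} {X : normedModType R}.
Implicit Types (A : bounded_op X X) (x : X).

Lemma op_powD A m n x : op_pow A (m + n) x = op_pow A m (op_pow A n x).
Proof. by elim: m => //= m ->. Qed.

Lemma op_powSr A n x : op_pow A n.+1 x = op_pow A n (A x).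
Proof. by rewrite -addn1 op_powD. Qed.

Lemma op_pow_adjoint A n (f : topdual X) x :
  op_pow (adjoint A) n f x = f (op_pow A n x).
Proof. by elim: n x => //= n IH x; rewrite IH -op_powSr. Qed.

Lemma op_pow_comm A (h : X -> X) n x :
  (forall y, h (A y) = A (h y)) -> h (op_pow A n x) = op_pow A n (h x).
Proof. by move=> hA; elim: n => //= n <-. Qed.

Lemma op_pow_eigen A a n x : A x = a *: x -> op_pow A n x = a ^+ n *: x.
Proof.
move=> Ax; elim: n => [|n IH]; first by rewrite scale1r.
by rewrite op_powSr Ax linearZ /= IH scalerA exprS.
Qed.

Lemma op_pow_fix A n x : A x = x -> op_pow A n x = x.
Proof. by move=> Ax; rewrite (@op_pow_eigen _ 1) ?expr1n scale1r. Qed.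

Lemma cvg_op_pow_fix A x : A x = x -> op_pow A n x @[n --> \oo] --> x.
Proof.
move=> Ax; rewrite (_ : (fun n => op_pow A n x) = cst x); first exact: cvg_cst.
by apply/funext => n; rewrite op_pow_fix.
Qed.

Lemma power_bound A :
  (ereal_sup [set (`|op_pow A n|)%:E | n in [set n | (0 < n)%N]] < +oo)%E ->
  exists B, forall n x, `|op_pow A n x| <= B * `|x|.
Proof.
set s := ereal_sup _ => soo.
have le_s n : (0 < n)%N -> ((`|op_pow A n|)%:E <= s)%E.
  by move=> n0; apply: ereal_sup_ubound; exists n.
have sfin : s \is a fin_num.
  by apply: fin_real; rewrite soo andbT (lt_le_trans _ (le_s 1%N _)) ?ltNyr.
(* The power [n = 0] is not covered by the supremum. *)
exists (Num.max 1 (fine s)) => -[|n] x; first by rewrite /= -[leLHS]mul1r ler_wpM2r// le_max lexx.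
apply: le_trans (le_opnorm _ x) _; rewrite ler_wpM2r// le_max; apply/orP; right.
by rewrite -lee_fin fineK// le_s.
Qed.

Section PowerBounded.
Context {A : bounded_op X X} {B : R}.
Context (A_bound : forall n x, `|op_pow A n x| <= B * `|x|).

(** Once the orbit is within [eps] of the fixed point [z], all later terms are
    within [B * eps] of it, because [z - A^(m + n) x = A^m (z - A^n x)]. *)
Lemma cvg_of_near_fixpoint x z : A z = z ->
  (forall eps, 0 < eps -> exists n, `|z - op_pow A n x| < eps) ->
  op_pow A n x @[n --> \oo] --> z.
Proof.
move=> Az xz; have B0 : 0 < `|B| + 1 by rewrite ltr_wpDl.
apply/cvgrPdist_le => eps e0.
(* [`|B| + 1] replaces [B] as a divisor, which may be [0]. *)
have [n zn] := xz _ (divr_gt0 e0 B0).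
exists n => // m /= nm.
rewrite -(subnK nm) op_powD -{1}(op_pow_fix (m - n) Az) -linearB.
apply: le_trans (A_bound _ _) _.
apply: (@le_trans _ _ ((`|B| + 1) * `|z - op_pow A n x|)).
  by rewrite ler_wpM2r// (le_trans (ler_norm B))// lerDl.
by rewrite mulrC -ler_pdivlMr// ltW.
Qed.

(** The coefficient of [u] in the limit is determined by the orbit since [u] is
    not [0]; linearity and boundedness then pass to the limit. *)
Lemma limit_functional u : u != 0 ->
  (forall x, exists c : R, op_pow A n x @[n --> \oo] --> c *: u) ->
  exists f : topdual X, forall x, op_pow A n x @[n --> \oo] --> (f x : R) *: u.
Proof.
move=> u0 /choice[c Ac].
have c_eq x a : op_pow A n x @[n --> \oo] --> a *: u -> c x = a.
  move=> Aa; apply: (scaler_injl u0).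
  by apply: (cvg_unique _ (Ac x) Aa); exact: norm_hausdorff.
have c_lin : linear (c : X -> R^o).
  move=> a x y; apply: c_eq; rewrite scalerDl -scalerA.
  under eq_fun do rewrite linearP.
  exact: (cvgD (cvgZ (cvg_cst a) (Ac x)) (Ac y)).
have c_bound x : `|c x : R^o| <= B / `|u| * `|x|.
  rewrite mulrAC ler_pdivlMr ?normr_gt0// -normrZ.
  have cu : `|op_pow A n x| @[n --> \oo] --> `|c x *: u| by apply: cvg_norm.
  by apply: (cvgr_to_le cu); apply: nearW => n; exact: A_bound.
by exists (BoundedOp (contlinP c_lin c_bound)).
Qed.

End PowerBounded.
End Powers.

(** * Orbits under a power-compact operator *)

Section CompactPowers.
Context {R : realType} {X : normedModType R} {A : bounded_op X X}.
Context {k : nat} {B : R}.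
Context (A_compact : compact_op (op_pow A k)).
Context (A_bound : forall n x, `|op_pow A n x| <= B * `|x|).

(** The orbit from time [k] on is written as an image under [A^k] so that the
    compactness of this power applies to it directly. *)
Definition tail_closure (x : X) : set X :=
  closure (op_pow A k @` range (fun n => op_pow A n x)).

Lemma tail_closure_compact x : compact (tail_closure x).
Proof.
rewrite -precompactE; apply: A_compact.
exists (B * `|x|); split; first exact: num_real.
by move=> M /ltW BM _ [n _ <-]; apply: le_trans BM.
Qed.

Lemma tail_closure_ind x (P : set X) : closed P ->
  (forall n, P (op_pow A n x)) -> tail_closure x `<=` P.
Proof.
move=> Pcl Pn; rewrite (closure_id P).1//; apply: closure_subset.
by move=> _ [_ [n _ <-] <-]; rewrite -op_powD.
Qed.

Lemma tail_closure_neq0 x : tail_closure x !=set0.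
Proof.
exists (op_pow A k x); apply: subset_closure.
by exists x => //; exists 0%N.
Qed.

Lemma tail_closure_stable x z : tail_closure x z -> tail_closure x (A z).
Proof.
move=> xz U AzU.
have [_ [[_ [n _ <-] <-] UA]] := xz _ (bounded_op_continuous AzU).
exists (A (op_pow A k (op_pow A n x))); split => //.
by exists (op_pow A n.+1 x); [exists n.+1|rewrite -op_powSr].
Qed.

Lemma cvg_of_fixed_cluster x z : tail_closure x z -> A z = z ->
  op_pow A n x @[n --> \oo] --> z.
Proof.
move=> xz Az; apply: (cvg_of_near_fixpoint A_bound Az) => eps e0.
have [_ [[_ [n _ <-] <-]]] := xz _ (nbhsx_ballx z _ e0).
by rewrite -ball_normE /= -op_powD; exists (k + n)%N.
Qed.

(** Pointwise convergence of equicontinuous maps is uniform on compact sets, in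
    particular on the closure [Q] of the image of the unit ball under [A^k];
    since [A0 = A0 A^k], this bounds [A^(m + k) - A0] on the unit ball. *)
Lemma opnorm_cvg (A0 : bounded_op X X) :
  (forall x, op_pow A n x @[n --> \oo] --> A0 x) ->
  `|op_pow A n - A0| @[n --> \oo] --> 0.
Proof.
move=> AA0; have B0 : 0 < `|B| + `|A0| + 1 by rewrite ltr_wpDl// addr_ge0.
pose Q := closure (op_pow A k @` [set x | `|x| <= 1]).
have Qc : compact Q.
  rewrite -precompactE; apply: A_compact; exists 1.
  split; first exact: num_real.
  by move=> M /ltW M1 x /= x1; apply: le_trans M1.
have A0k x : A0 (op_pow A k x) = A0 x.
  apply: (cvg_unique _ (AA0 (op_pow A k x))); first exact: norm_hausdorff.
  have := AA0 x; rewrite -(cvg_shiftn k) /=.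
  by under eq_fun do rewrite op_powD.
apply/cvgr0Pnorm_le => eps e0.
have : \forall n \near \oo, Q `<=` [set y | `|op_pow A n y - A0 y| <= eps].
  apply: (compact_near_coveringP Q).1 Qc _ \oo _ _ _ => y Qy.
  have e2 : 0 < eps / 2 by rewrite divr_gt0.
  (* Half of [eps] for convergence at [y], half for equicontinuity near [y]. *)
  exists (ball y (eps / 2 / (`|B| + `|A0| + 1)),
    [set n | `|A0 y - op_pow A n y| <= eps / 2]) => /=.
    split; first by apply: nbhsx_ballx; exact: divr_gt0.
    by have /cvgrPdist_le := AA0 y; apply.
  move=> [y' n] /= [+ yn]; rewrite -ball_normE /= => yy'.
  have -> : op_pow A n y' - A0 y' =
      (A0 (y - y') - op_pow A n (y - y')) + (op_pow A n y - A0 y).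
    rewrite !linearB/= opprK (addrC (- _)) -addrA subrKA.
    by rewrite addrC subrKA.
  apply: le_trans (ler_normD _ _) _; rewrite [leRHS]splitr.
  apply: lerD; last by rewrite distrC.
  apply: (@le_trans _ _ ((`|B| + `|A0| + 1) * `|y - y'|)).
    apply: le_trans (ler_normB _ _) _.
    rewrite (addrC `|B|) -addrA mulrDl; apply: lerD; first exact: le_opnorm.
    apply: le_trans (A_bound _ _) _.
    by rewrite ler_wpM2r// (le_trans (ler_norm B))// lerDl.
  by rewrite mulrC -ler_pdivlMr// ltW.
move=> [m _ mQ]; exists (m + k)%N => // n /= kn; rewrite normr_id.
apply: ge_sup; first by exists `|(op_pow A n - A0) 0|, 0 => //=; rewrite normr0.
move=> _ [x /= x1 <-].
have nk : (k <= n)%N by apply: leq_trans kn; rewrite leq_addl.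
change (`|op_pow A n x - A0 x| <= eps).
rewrite -A0k -{1}(subnK nk) op_powD.
apply: mQ; last by apply: subset_closure; exists x.
by rewrite /= leq_subRL// addnC.
Qed.

End CompactPowers.
Arguments tail_closure {R X} A k x.

(** * Strongly positive operators *)

Section StronglyPositive.
Context {R : realType} {X : normedModType R} {K : set X} {A : bounded_op X X}.
Context (K_cone : cone K) (K_closed : closed K).
Context (A_int : forall x, K x -> x != 0 ->
  exists2 n : nat, (0 < n)%N & K° (op_pow A n x)).

(** Minimise [c] subject to [h z <= c *: g z] with [z] in [Om].  By compactness
    the infimum is attained; if [h z] and [c *: g z] differed at a minimiser,
    some [A^n] would make their difference interior, and at [A^n z], which is
    again in [Om], a smaller [c] would do. *)
Lemma compact_ratio_attained (Om : set X) (g h : X -> X) :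
  compact Om -> Om !=set0 -> (forall z, Om z -> Om (A z)) ->
  continuous g -> continuous h ->
  (forall z, g (A z) = A (g z)) -> (forall z, h (A z) = A (h z)) ->
  (forall z, Om z -> K (g z) /\ g z != 0) ->
  has_lbound [set c : R | exists2 z, Om z & K (c *: g z - h z)] ->
  exists2 z, Om z & exists c : R, h z = c *: g z.
Proof.
move=> Om_compact [z0 Omz0] OmA gc hc gA hA gK S_lb.
set S := [set c : R | _] in S_lb.
have OmAn n z : Om z -> Om (op_pow A n z) by elim: n => //= n IH /IH/OmA.
have S_neq0 : S !=set0.
  have [Kg g0] := gK _ Omz0.
  have [n _ /(interior_order_unit K_cone)[C _ CK]] := A_int Kg g0.
  exists (C * `|h (op_pow A n z0)|), (op_pow A n z0); first exact: OmAn.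
  by rewrite (op_pow_comm _ _ gA).
set c := inf S.
have [z Omz Kz] : exists2 z, Om z & K (c *: g z - h z).
  (* If no [z] works for the infimum [c] then, the cone being closed and [Om]
     compact, none works for [c + eps] when [eps] is small. *)
  apply: contrapT => noz.
  have : \forall eps \near 0^'+, Om `<=` [set z | ~ K ((c + eps) *: g z - h z)].
    apply: (compact_near_coveringP Om).1 Om_compact _ 0^'+ _ _ _ => z Omz.
    have cv : (c + p.2) *: g p.1 - h p.1 @[p --> (z, 0^'+)] -->
        (c + 0) *: g z - h z.
      apply: cvgB.
        apply: cvgZ; last exact: (cvg_comp fst g cvg_fst (gc z)).
        apply: cvgD; first exact: cvg_cst.
        by apply: (cvg_trans cvg_snd); exact: cvg_within.
      exact: (cvg_comp fst h cvg_fst (hc z)).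
    have nK : nbhs ((c + 0) *: g z - h z) (~` K).
      apply: open_nbhs_nbhs; split; first exact: closed_openC.
      by rewrite addr0 => Kz; apply: noz; exists z.
    exact: cv nK.
  move=> H.
  have [eps [/= Heps eps0]] := filter_ex (filterI H (nbhs_right_gt 0)).
  have [c' [z Omz Kz] c'c] := inf_adherent eps0 (conj S_neq0 S_lb).
  apply: (Heps _ Omz); have [Kg _] := gK _ Omz.
  rewrite -(subrK c' (c + eps)) scalerDl -addrA; apply: coneD => //.
  by apply: coneZ => //; rewrite subr_ge0 ltW.
exists z => //; exists c; apply/esym/eqP; rewrite -subr_eq0.
apply/negPn/negP => neq.
have [n _ /(interior_absorb K_cone)] := A_int Kz neq.
move=> /(_ (op_pow A n (g z)))[eps eps0].
rewrite linearB linearZ /= addrAC -scalerBl.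
rewrite -(op_pow_comm _ _ gA) -(op_pow_comm _ _ hA) => Keps.
have : c <= c - eps.
  by apply: ge_inf => //; exists (op_pow A n z) => //; exact: OmAn.
by rewrite lerBrDr gerDl leNgt eps0.
Qed.

Context {k : nat} {B : R}.
Context (A_compact : compact_op (op_pow A k)).
Context (A_bound : forall n x, `|op_pow A n x| <= B * `|x|).
Context (A_pos : positive_op K A).

Lemma op_pow_pos n x : K x -> K (op_pow A n x).
Proof. by elim: n => //= n IH /IH Kx; apply: A_pos; exists (op_pow A n x). Qed.

Lemma eigenvector_scale_ge0 c z : K z -> z != 0 -> A z = c *: z -> 0 <= c.
Proof.
move=> Kz z0 Az; apply: (cone_scale_ge0 K_cone Kz z0).
by rewrite -Az; exact: (op_pow_pos 1 Kz).
Qed.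

(** Some [A^n z] is interior, and it is a positive multiple of [z]. *)
Lemma eigenvector_interior c z : K z -> z != 0 -> A z = c *: z -> K° z.
Proof.
move=> Kz z0 Az; have c_ge0 := eigenvector_scale_ge0 Kz z0 Az.
have [n _] := A_int Kz z0; rewrite (op_pow_eigen _ Az) => Kn.
have := interior_neq0 K_cone Kn Kz z0.
rewrite scaler_eq0 negb_or => /andP[cn0 _].
apply: (interior_ge K_cone _ Kn (a := (c ^+ n)^-1)).
  by rewrite invr_gt0 lt0r cn0 exprn_ge0.
by rewrite scalerA mulVf// scale1r subrr; exact: cone0.
Qed.

(** If [c > 1] the powers of [A] would be unbounded at [z].  If [c < 1] then,
    [e] being bounded by a multiple of [z], the orbit of [e] would tend to
    [0]. *)
Lemma interior_eigenvalue_eq1 c z e c0 : normal_cone K ->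
  K° z -> z != 0 -> A z = c *: z ->
  K e -> 0 < c0 -> (forall n, c0 <= `|op_pow A n e|) -> c = 1.
Proof.
move=> /normal_le_norm[N N0 NK] Kiz z0 Az Ke c00 c0A.
have Kz : K z by exact: interior_subset.
have c_ge0 := eigenvector_scale_ge0 Kz z0 Az.
have nz : 0 < `|z| by rewrite normr_gt0.
apply/eqP; rewrite eq_le !leNgt; apply/andP; split; apply/negP => c1.
  have c_gt0 : 0 < c by exact: lt_trans c1.
  have [|n] := @geometric_small _ (B * `|z|) c^-1 `|z| _ nz.
    by rewrite invr_ge0 ltW//= invf_lt1.
  rewrite exprVn ltr_pdivrMr ?exprn_gt0// ltNge => /negP; apply.
  have := A_bound n z.
  rewrite (op_pow_eigen _ Az) normrZ ger0_norm ?exprn_ge0//.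
  by rewrite mulrC.
have [C C0 CK] := interior_order_unit K_cone Kiz.
have [|n] := @geometric_small _ (N * (C * `|e|) * `|z|) c c0 _ c00.
  by rewrite c_ge0.
rewrite ltNge => /negP; apply.
have := NK (op_pow A n e) ((C * `|e|) *: op_pow A n z).
rewrite (op_pow_eigen _ Az) scalerA normrZ.
rewrite ger0_norm ?mulr_ge0 ?exprn_ge0 ?(ltW C0)// => le.
apply: le_trans (c0A n) _; apply: le_trans (le _ _) _.
- have := op_pow_pos n (CK e); rewrite linearB linearZ /= (op_pow_eigen _ Az).
  by rewrite scalerA.
- apply: coneD => //; last exact: op_pow_pos.
  by apply: coneZ => //; rewrite ?mulr_ge0 ?exprn_ge0 ?(ltW C0).
by rewrite !mulrA mulrAC.
Qed.

Lemma interior_fixpoint e c0 : normal_cone K -> K° e -> 0 < c0 ->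
  (forall n, c0 <= `|op_pow A n e|) ->
  exists2 u, K° u & u != 0 /\ A u = u.
Proof.
move=> K_normal Kie c00 c0A.
have Ke : K e by exact: interior_subset.
have OmK : tail_closure A k e `<=` K.
  by apply: tail_closure_ind => // n; exact: op_pow_pos.
have Om_ge : tail_closure A k e `<=` [set z | c0 <= `|z|].
  apply: tail_closure_ind => //.
  apply: (@closed_comp _ _ (fun z : X => `|z|) [set r | c0 <= r]).
    by move=> z _; exact: norm_continuous.
  exact: closed_ge.
have Om_neq0 z : tail_closure A k e z -> z != 0.
  by move=> /Om_ge /= c0z; rewrite -normr_gt0 (lt_le_trans c00).
have [z Omz [c Az]] :
    exists2 z, tail_closure A k e z & exists c : R, A z = c *: z.
  apply: (compact_ratio_attained (g := id) (h := A)) => //.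
  - exact: tail_closure_compact A_compact A_bound _.
  - exact: tail_closure_neq0.
  - exact: tail_closure_stable.
  - by move=> z; exact: cvg_id.
  - exact: bounded_op_continuous.
  - by move=> z Omz; split; [exact: OmK|exact: Om_neq0].
  exists 0 => c [z Omz Kcz].
  apply: (cone_scale_ge0 K_cone (OmK _ Omz) (Om_neq0 _ Omz)).
  rewrite -(subrK (A z) (c *: z)); apply: coneD => //.
  exact: (op_pow_pos 1 (OmK _ Omz)).
have z0 := Om_neq0 _ Omz; have Kiz := eigenvector_interior (OmK _ Omz) z0 Az.
exists z => //; split => //; rewrite Az.
by rewrite (interior_eigenvalue_eq1 K_normal Kiz z0 Az Ke c00 c0A) scale1r.
Qed.

(** Here the minimal [c] is that for which [z <= c *: u] has a solution in the
    orbit closure; it is bounded below since the orbit is. *)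
Lemma cvg_to_fixed_line u x : K° u -> u != 0 -> A u = u ->
  exists c : R, op_pow A n x @[n --> \oo] --> c *: u.
Proof.
move=> Ku u0 Au; have Ku' : K u by exact: interior_subset.
have Omc : compact (tail_closure A k x).
  exact: tail_closure_compact A_compact A_bound _.
have [C C0 CK] := interior_order_unit K_cone Ku.
have [M [_ /(_ (M + 1)) OmM]] := compact_bounded Omc.
have {OmM} OmM : forall z, tail_closure A k x z -> `|z| <= M + 1.
  by apply: OmM; rewrite ltrDl.
have [z Omz [c zu]] :
    exists2 z, tail_closure A k x z & exists c : R, z = c *: u.
  apply: (compact_ratio_attained (g := cst u) (h := id)) => //.
  - exact: tail_closure_neq0.
  - exact: tail_closure_stable.
  - exact: cst_continuous.
  - by move=> z; exact: cvg_id.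
  exists (- (C * (M + 1))) => c [z /OmM zM Kcz].
  apply: (@le_trans _ _ (- (C * `|z|))); first by rewrite lerN2 ler_pM2l.
  rewrite -subr_ge0 opprK; apply: (cone_scale_ge0 K_cone Ku' u0).
  rewrite scalerDl -(subrK z (c *: u)) -addrA; apply: coneD => //.
  by have := CK (- z); rewrite normrN opprK addrC.
exists c; rewrite -zu; apply: (cvg_of_fixed_cluster A_bound Omz).
by rewrite zu linearZ /= Au.
Qed.

(** [A^n x] lies between the multiples [- C |x|] and [C |x|] of [A^n e]. *)
Lemma cvg0_of_order_unit e : normal_cone K -> K° e ->
  op_pow A n e @[n --> \oo] --> 0 -> forall x, op_pow A n x @[n --> \oo] --> 0.
Proof.
move=> /(normal_le_norm)[N N0 NK] Ke Ae x.
have [C C0 CK] := interior_order_unit K_cone Ke.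
have : (C * `|x|) *: op_pow A n e @[n --> \oo] --> (C * `|x|) *: 0.
  exact: (cvgZ (cvg_cst _) Ae).
rewrite scaler0 => /cvgr0Pnorm_le H.
apply/cvgr0Pnorm_le => eps e0; have := H _ (divr_gt0 e0 N0).
apply: filterS => n le_n.
apply: le_trans (NK _ ((C * `|x|) *: op_pow A n e) _ _) _.
- by have := op_pow_pos n (CK x); rewrite linearB linearZ.
- by have := op_pow_pos n (CK (- x)); rewrite opprK normrN linearD linearZ.
by rewrite mulrC -ler_pdivlMr.
Qed.

End StronglyPositive.

(** * The limit operator *)

Lemma adjoint_cvg (R : realType) (X : normedModType R)
    (T : nat -> bounded_op X X) (T0 : bounded_op X X) :
  `|T n - T0| @[n --> \oo] --> 0 ->
  `|adjoint (T n) - adjoint T0| @[n --> \oo] --> 0.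
Proof.
move=> /cvgr0Pnorm_le H; apply/cvgr0Pnorm_le => eps /H; apply: filterS => n.
rewrite !normr_id; apply: le_trans; apply: opnorm_le => // f.
apply: opnorm_le => [|x]; first by rewrite mulr_ge0.
change (`|f (T n x) - f (T0 x)| <= `|T n - T0| * `|f| * `|x|).
rewrite -linearB; apply: le_trans (le_opnorm _ _) _.
rewrite [leRHS]mulrAC [leRHS]mulrC; apply: ler_wpM2l; first exact: opnorm_ge0.
exact: (le_opnorm (T n - T0) x).
Qed.

Lemma weak_star_cvg (R : realType) (X : normedModType R) (F : nat -> topdual X)
    (f : topdual X) : (forall x, (F n x : R^o) @[n --> \oo] --> (f x : R^o)) ->
  (F n : weak_star X) @[n --> \oo] --> (f : weak_star X).
Proof.
move=> Ff; apply/cvg_sup => x U [_ [[V Vop <-] Vf] VU].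
have nV : nbhs (f x : R^o) V by apply: open_nbhs_nbhs.
change (\forall n \near \oo, U (F n)).
have H : \forall n \near \oo, V (F n x) by exact: Ff x _ nV.
by apply: filterS H => n Vn; exact: VU.
Qed.

Section RankOneLimit.
Context {R : realType} {X : normedModType R} {A : bounded_op X X}.
Context {u : X} {f : topdual X} (u0 : u != 0) (Au : A u = u).
Context (Af : forall x, op_pow A n x @[n --> \oo] --> (f x : R) *: u).

Lemma limit_coef_unique x (a : R) :
  op_pow A n x @[n --> \oo] --> a *: u -> f x = a.
Proof.
move=> Aa; apply: (scaler_injl u0).
by apply: (cvg_unique _ (@Af x) Aa); exact: norm_hausdorff.
Qed.

Lemma fixpoint_limit_coef x : A x = x -> x = (f x : R) *: u.
Proof.
move=> Ax; apply: (cvg_unique _ _ (@Af x)); first exact: norm_hausdorff.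
exact: cvg_op_pow_fix.
Qed.

Lemma limit_coef_fixed : f u = 1.
Proof. by apply: limit_coef_unique; rewrite scale1r; exact: cvg_op_pow_fix. Qed.

Lemma limit_coef_op x : f (A x) = f x.
Proof.
apply: limit_coef_unique.
rewrite (_ : (fun n => _) = (fun n => op_pow A n.+1 x)); last first.
  by apply/funext => n; rewrite op_powSr.
by rewrite (cvg_shiftS (fun n => op_pow A n x)).
Qed.

Lemma limit_coef_op_pow n x : f (op_pow A n x) = f x.
Proof. by elim: n => //= n <-; rewrite limit_coef_op. Qed.

Lemma functional_orbit_cvg (g : topdual X) x :
  (g (op_pow A n x) : R^o) @[n --> \oo] --> (g ((f x : R) *: u) : R^o).
Proof.
apply: (cvg_comp (fun n => op_pow A n x) g (@Af x)).
exact: bounded_op_continuous.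
Qed.

(** A functional [g] fixed by the adjoint is constant along orbits, so
    [g x = g (f(x) u)]. *)
Lemma fixed_functional (g : topdual X) :
  adjoint A g = g -> g = (g u : R) *: f.
Proof.
move=> Ag; apply: bounded_op_eqP => x.
have gA n : g (op_pow A n x) = g x.
  by rewrite -op_pow_adjoint (op_pow_fix (A := adjoint A) _ Ag).
have := @functional_orbit_cvg g x.
rewrite (_ : (fun n => _) = cst (g x)); last exact/funext.
move=> /(cvg_unique _ (cvg_cst (g x))).
rewrite linearZ /= => ->; first exact: mulrC.
exact: norm_hausdorff.
Qed.

Lemma adjoint_limit_coef : adjoint A f = f.
Proof. by apply: bounded_op_eqP => x; exact: limit_coef_op. Qed.

Lemma simple_eigenvalue1 : simple_eigenvalue A 1.
Proof.
exists u => //; apply/seteqP; split => [x|_ [c _ <-]];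
  rewrite /eigenspace_op /= scale1r.
  by move=> Ax; exists (f x : R) => //; rewrite -fixpoint_limit_coef.
by rewrite linearZ /= Au.
Qed.

Lemma simple_eigenvalue1_adjoint : simple_eigenvalue (adjoint A) 1.
Proof.
exists f.
  apply/eqP => f0; have := limit_coef_fixed.
  by rewrite f0 => /eqP; rewrite eq_sym oner_eq0.
apply/seteqP; split => [g|_ [c _ <-]]; rewrite /eigenspace_op /= scale1r.
  by move=> Ag; exists (g u : R) => //; rewrite -fixed_functional.
apply: bounded_op_eqP => x.
exact: (congr1 (fun t : R => c * t) (limit_coef_op x)).
Qed.

End RankOneLimit.

Theorem theorem6 (R : realType) (X : completeNormedModType R) (K : set X)
    (A : bounded_op X X)
    (K_cone : cone K) (K_closed : closed K) (K_normal : normal_cone K)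
    (K_int : K° !=set0)
    (A_pos : positive_op K A)
    (A_int : forall x, K x -> x != 0 ->
      exists2 n : nat, (0 < n)%N & (K°) (op_pow A n x))
    (A_compact : exists2 k : nat, (0 < k)%N & compact_op (op_pow A k))
    (A_bounded :
      (ereal_sup [set (`|op_pow A n|)%:E | n in [set n | (0 < n)%N]] < +oo)%E) :
  exists A0 : bounded_op X X,
    [/\ forall x : X, op_pow A n x @[n --> \oo] --> A0 x,
        A0 != 0 ->
        exists (u : X) (f0 : topdual X),
          (K°) u /\ dual_cone K f0 /\
          [/\ [/\ A u = u, adjoint A f0 = f0, f0 u = 1 &
                  forall x, K x -> x != 0 -> 0 < f0 x],
              A0 = rank_one f0 u,
              forall f : topdual X,
                (op_pow (adjoint A) n f : weak_star X) @[n --> \oo] -->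
                  (adjoint A0 f : weak_star X) &
              simple_eigenvalue A 1 /\ simple_eigenvalue (adjoint A) 1],
        `|op_pow A n - A0| @[n --> \oo] --> 0 &
        `|adjoint (op_pow A n) - adjoint A0| @[n --> \oo] --> 0].
Proof.
have [B A_bd] := power_bound A_bounded.
have [k _ Ak] := A_compact.
have [e Ke] := K_int.
have [dec|nodec] := pselect (forall eps : R, 0 < eps ->
    exists n, `|op_pow A n e| < eps).
  have Ae : op_pow A n e @[n --> \oo] --> 0.
    apply: (cvg_of_near_fixpoint A_bd); first exact: linear0.
    by move=> eps /dec[n en]; exists n; rewrite sub0r normrN.
  have A0 := cvg0_of_order_unit K_cone A_pos K_normal Ke Ae.
  exists 0; split => //; first by rewrite eqxx.
  - exact: (opnorm_cvg Ak A_bd (A0 := 0)).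
  - by apply: adjoint_cvg; exact: (opnorm_cvg Ak A_bd (A0 := 0)).
have [c0 c00 c0A] : exists2 c0 : R, 0 < c0 & forall n, c0 <= `|op_pow A n e|.
  apply: contrapT => H; apply: nodec => eps eps0; apply: contrapT => H'.
  apply: H; exists eps => // n; rewrite leNgt; apply/negP => ?.
  by apply: H'; exists n.
have [u Ku [u0 Au]] :=
  interior_fixpoint K_cone K_closed A_int Ak A_bd A_pos K_normal Ke c00 c0A.
have Ku' : K u by exact: interior_subset.
have [f Af] := limit_functional A_bd u0
  (fun x => cvg_to_fixed_line K_cone K_closed A_int Ak A_bd x Ku u0 Au).
have fu := limit_coef_fixed u0 Au Af.
have f_pos : dual_cone K f.
  move=> x Kx; apply: (cone_scale_ge0 K_cone Ku' u0).
  apply: (closed_cvg K K_closed _ _ (Af x)).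
  by apply: nearW => n; exact: (op_pow_pos A_pos).
exists (rank_one f u); split.
- exact: Af.
- move=> _; exists u, f; split => //; split => //; split.
  + split => //; first exact: (adjoint_limit_coef u0 Af).
    (* [f] takes the same value at [x] and at an interior [A^n x >= a *: u]. *)
    move=> x Kx x0.
    have [n _ /(interior_absorb K_cone u)[a a0 Ka]] := A_int x Kx x0.
    apply: (lt_le_trans a0); rewrite -(limit_coef_op_pow u0 Af n) -subr_ge0.
    by have := f_pos _ Ka; rewrite linearB linearZ /= fu /GRing.scale /= mulr1.
  + by [].
  + move=> g; apply: weak_star_cvg => x.
    rewrite (_ : (fun n => _) = (fun n => g (op_pow A n x))); last first.
      by apply/funext => n; rewrite op_pow_adjoint.
    exact: functional_orbit_cvg.
  + split; first exact: (simple_eigenvalue1 u0 Au Af).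
    exact: (simple_eigenvalue1_adjoint u0 Au Af).
- exact: (opnorm_cvg Ak A_bd).
- by apply: adjoint_cvg; exact: (opnorm_cvg Ak A_bd).
Qed.
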